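(* Let $\Lambda\colon\mathbb{R}\to[0,1]$ have bounded variation and be right-continuous, and let $\mu_\Lambda$ be its associated finite signed Borel measure on $\mathbb{R}$. For $g\in\mathcal S$, the following are equivalent: (a) $\Lambda\circ g=\Lambda$. (b) $g$ is a measure-preserving transformation of $(\mathbb{R},\mathcal B(\mathbb{R}),\mu_\Lambda)$, i.e. $\mu_\Lambda(g^{-1}(A))=\mu_\Lambda(A)$ for all $A\in\mathcal B(\mathbb{R})$. (c) $g(x)=x$ for all $x\in\operatorname{supp}(\mu_\Lambda)$.
   Context: $\mathcal S$ is the set of all strictly increasing, continuous and surjective functions $g\colon\mathbb{R}\to\mathbb{R}$. Bounded variation means $\sup\{\sum_{i=1}^n|\Lambda(x_i)-\Lambda(x_{i-1})| : n\in\mathbb{N},\ x_0<\dots<x_n\}<\infty$; then $\Lambda(-\infty):=\lim_{x\to-\infty}\Lambda(x)$ exists. $\mu_\Lambda$ is the unique finite signed measure on $(\mathbb{R},\mathcal B(\mathbb{R}))$ with $\mu_\Lambda((-\infty,x])=\Lambda(x)-\Lambda(-\infty)$ for all $x\in\mathbb{R}$. $\operatorname{supp}(\mu_\Lambda)$ is the support of the total variation measure $|\mu_\Lambda|$, i.e. the set of $x$ such that $|\mu_\Lambda|(U)>0$ for every open neighbourhood $U$ of $x$. *)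

(* Defs.v *)
From mathcomp Require Import all_boot all_order all_algebra.
From mathcomp Require Import all_classical all_reals all_analysis.

Set Implicit Arguments.
Unset Strict Implicit.
Unset Printing Implicit Defensive.

Import Order.TTheory GRing.Theory Num.Theory.
Import numFieldNormedType.Exports.

Local Open Scope classical_set_scope.
Local Open Scope ring_scope.

(* [variations a b f] collects the sums of |f x_i - f x_(i-1)| over the finite
   sequences a = x_0 < x_1 < ... < x_n = b. *)
Definition bounded_variationT (R : realType) (f : R -> R) : Prop :=
  has_ubound [set v : R | exists a b : R, variations a b f v].

(* A charge takes finite values on measurable sets. The limit at -oo exists
   whenever [f] has bounded variation, and a charge satisfying this equation is
   then unique on Borel sets: the half-lines `]-oo, x] form a pi-system
   generating them, and setT is their increasing union. *)
Definition is_associated_charge (R : realType) (f : R -> R)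
    (mu : {charge set (measurableTypeR R) -> \bar R}) : Prop :=
  forall x : R, mu `]-oo, x]%classic = (f x - lim (f y @[y --> -oo]))%:E.

(* The Hahn decomposition is chosen arbitrarily; [tv_chargeE] shows that the
   result does not depend on it. *)
Definition tv_charge d (T : measurableType d) (R : realType)
    (nu : {charge set T -> \bar R}) : set T -> \bar R :=
  charge_variation (projT2 (cid (projT2 (cid (Hahn_decomposition nu))))).

Lemma tv_chargeE d (T : measurableType d) (R : realType)
    (nu : {charge set T -> \bar R}) (P N : set T)
    (nuPN : hahn_decomposition nu P N) (A : set T) :
  measurable A -> tv_charge nu A = charge_variation nuPN A.
Proof.
move=> mA; rewrite /tv_charge /charge_variation/=.
rewrite !jordan_posE !cjordan_posE !jordan_negE !cjordan_negE.
rewrite /crestr0 mem_set// /crestr.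
have := Hahn_decomposition_uniq
  (projT2 (cid (projT2 (cid (Hahn_decomposition nu))))) nuPN mA.
by case=> -> ->.
Qed.

Definition charge_support (R : realType)
    (nu : {charge set (measurableTypeR R) -> \bar R}) : set R :=
  [set x : R | forall U : set R, open U -> U x -> (0 < tv_charge nu U)%E].

Definition time_change (R : realType) (g : R -> R) : Prop :=
  [/\ {homo g : x y / x < y}, continuous g & set_surj [set: R] [set: R] g].

(* Measurability of [g] is automatic for the continuous maps considered here. *)
Definition charge_preserving (R : realType)
    (nu : {charge set (measurableTypeR R) -> \bar R}) (g : R -> R) : Prop :=
  forall A : set (measurableTypeR R), measurable A -> nu (g @^-1` A) = nu A.

(* Main.v *)
(* (a) => (b): by (a), [mu] and its image under [g] agree on the rays ]x, +oo[,
   hence on all Borel sets. (b) => (c): a non-fixed point has a neighbourhood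
   that never meets its iterates under [g]; a finite invariant charge vanishes
   on every Borel part of such a wandering set. (c) => (a): the closed interval
   between [x] and [g x] misses the support unless [g x = x], because a fixed
   point there would separate [x] from [g x]; off the support [Lambda] is
   locally constant, so [Lambda x = Lambda (g x)]. *)
Require Import Defs.
From mathcomp Require Import all_boot all_order all_algebra.
From mathcomp Require Import all_classical all_reals all_analysis.

Import Order.TTheory GRing.Theory Num.Theory.
Import numFieldNormedType.Exports.

Local Open Scope classical_set_scope.
Local Open Scope ring_scope.

Set Implicit Arguments.
Unset Strict Implicit.

(* The iterated preimages of [B] are disjoint and have the same charge, so
   sigma-additivity forces that charge to be 0. *)
Lemma charge_wandering d (T : measurableType d) (R : realType)
    (nu : {charge set T -> \bar R}) (g : T -> T) (B : set T) :
  measurable_fun setT g ->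
  (forall A, measurable A -> nu (g @^-1` A) = nu A) ->
  measurable B ->
  (forall k x, B x -> ~ B (iter k.+1 g x)) ->
  nu B = 0%E.
Proof.
move=> mg nug mB wB; pose F n := iter n g @^-1` B.
have FS n : F n.+1 = g @^-1` F n.
  by apply/funext => x; rewrite /F /preimage/= -iterS iterSr.
have mF n : measurable (F n).
  elim: n => [//|n ih].
  by rewrite FS -[X in measurable X]setTI; exact: mg.
have nuF n : nu (F n) = nu B by elim: n => [//|n ih]; rewrite FS nug.
have wF i j x : (i < j)%N -> F i x -> ~ F j x.
  move=> ij; rewrite /F /preimage/= => Bi.
  by rewrite -(subnK ij) addnS -addSn iterD; exact: wB.
have tF : trivIset setT F.
  move=> i j _ _ [x [Fix Fjx]].
  by have [ij|ij|//] := ltngtP i j; [case: (wF _ _ x ij)|case: (wF _ _ x ij)].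
have := @charge_semi_sigma_additive _ _ _ nu F mF tF (bigcup_measurable (fun k _ => mF k)).
set U := \bigcup_n F n.
have mU : measurable U by exact: bigcup_measurable.
rewrite -(@fineK _ (nu U)) ?fin_num_measure// => /fine_cvgP[_ cvgU].
(* As [nu U] is finite, the series with constant term [nu B] converges in [R], so its term tends to
   0. *)
have cvg0 : (fun=> fine (nu B)) @ \oo --> (0 : R).
  apply: cvg_series_cvg_0; apply/cvg_ex; exists (fine (nu U)).
  apply: cvg_trans cvgU; apply: near_eq_cvg; apply: nearW => n /=.
  rewrite /series/= -sum_fine => [|i _]; last by rewrite fin_num_measure.
  by apply: eq_bigr => i _; rewrite nuF.
rewrite -(@fineK _ (nu B)) ?fin_num_measure//; congr EFin.
by apply: cvg_unique cvg0 => //; exact: cvg_cst.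
Qed.

Lemma charge_setC d (T : measurableType d) (R : realType)
    (nu : {charge set T -> \bar R}) (A : set T) :
  measurable A -> nu (~` A) = (nu setT - nu A)%E.
Proof. by move=> mA; rewrite -setTD chargeD// setTI. Qed.

(** Any [B] inside [U] has [|nu B|] at most the variation of [B], hence of [U]. Conversely the
    variation of [U] is the charge of its positive part minus that of its negative part, both
    subsets of [U]. *)
Lemma tv_charge_null d (T : measurableType d) (R : realType)
    (nu : {charge set T -> \bar R}) (U : set T) :
  measurable U ->
  ~ (0 < tv_charge nu U)%E <->
  (forall B, measurable B -> B `<=` U -> nu B = 0%E).
Proof.
move=> mU; have [P [N nuPN]] := Hahn_decomposition nu.
rewrite (tv_chargeE nuPN mU); split => [/negP|nu0].
  rewrite -leNgt => tv0 B mB BU; apply/eqP; rewrite -abse_eq0 eq_le abse_ge0 andbT.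
  apply: (le_trans (abse_charge_variation nuPN mB)); apply: le_trans tv0.
  by apply: le_measure => //; rewrite inE.
have [[mP _] [mN _] _ _] := nuPN.
rewrite /charge_variation/= jordan_posE cjordan_posE jordan_negE cjordan_negE.
rewrite /crestr0 mem_set// /crestr.
by rewrite !nu0 ?oppe0 ?adde0 ?ltxx//; exact: measurableI.
Qed.

(** The derivative is 0 at each point of the segment, so the mean value theorem applies. *)
Lemma locally_constant_segment (R : realType) (f : R -> R) (a b : R) :
  a <= b -> (forall z, z \in `[a, b] -> \forall t \near z, f t = f z) ->
  f a = f b.
Proof.
move=> ab lf.
have df z : z \in `[a, b] -> is_derive (z : R) (1:R) f 0.
  move=> /lf fz; apply: (near_eq_is_derive (f := cst (f z))) => //.
  by apply: filterS fz => t ->.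
have cf : {within `[a,b], continuous f}.
  apply: derivable_within_continuous => z zab.
  exact: (@ex_derive _ _ _ _ _ _ _ (df z zab)).
have dfo z : z \in `]a, b[ -> is_derive (z : R) (1:R) f (cst 0 z).
  by move=> /subset_itv_oo_cc/df.
have [c _ /eqP] := MVT_segment ab dfo cf.
by rewrite mul0r subr_eq0 => /eqP.
Qed.

Lemma associated_charge_oc (R : realType) (f : R -> R)
    (mu : {charge set (measurableTypeR R) -> \bar R}) (x y : R) :
  is_associated_charge f mu ->
  x <= y -> mu `]x, y]%classic = (f y - f x)%:E.
Proof.
move=> muf xy.
have -> : `]x, y]%classic = `]-oo, y] `\` `]-oo, x].
  apply/seteqP; split => z /=; rewrite !in_itv/= ltNge.
    by move=> /andP[/negP].
  by move=> [-> /negP ->].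
rewrite chargeD// setIidr; last by apply: subset_itvl; rewrite bnd_simp.
by rewrite !muf -EFinB opprB addrA subrK.
Qed.

(** Off the support, some ball around [z] has only null Borel subsets, and the increments of [f] in
    it are charges of half-open intervals that it contains. *)
Lemma charge_supportC_locally_constant (R : realType) (f : R -> R)
    (mu : {charge set (measurableTypeR R) -> \bar R}) (z : R) :
  is_associated_charge f mu ->
  ~ charge_support mu z -> \forall t \near z, f t = f z.
Proof.
move=> muf /existsNP[U /not_implyP[oU /not_implyP[Uz]]].
have mU : measurable (U : set (measurableTypeR R)).
  exact: measurable_realfun.open_measurable.
rewrite (tv_charge_null _ mU) => mu0.
have [e /= e0 eU] := (nbhs_ballP z U).1 (open_nbhs_nbhs (conj oU Uz)).
near=> t.
have : ball z e t by near: t; exact: nbhsx_ballx.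
have f_eq x y : x <= y -> `]x, y] `<=` ball z e -> f y = f x.
  move=> xy xyU; apply/eqP; rewrite -subr_eq0 -eqe.
  by rewrite -(associated_charge_oc muf xy) mu0//; exact: subset_trans eU.
rewrite ball_itv/= in_itv/= => /andP[et te].
have [zt|tz] := leP z t.
  apply: f_eq => // w /=; rewrite ball_itv/= !in_itv/= => /andP[zw wt].
  by rewrite (le_lt_trans wt te) andbT (lt_trans _ zw)// gtrBl.
apply/esym/f_eq; first exact: ltW.
move=> w /=; rewrite ball_itv/= !in_itv/= => /andP[tw wz].
by rewrite (lt_trans et tw)/= (le_lt_trans wz)// ltrDl.
Unshelve. all: by end_near. Qed.

Lemma wandering_interval (R : realType) (g : R -> R) (x : R) :
  {homo g : y z / y < z} -> set_surj [set: R] [set: R] g -> g x <> x ->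
  exists a b : R, x \in (`]a, b[) /\
    forall k w, w \in (`]a, b[) -> iter k.+1 g w \notin `]a, b[.
Proof.
move=> g_incr g_surj gx; have g_mono := leW_mono (le_mono g_incr).
(* The interval has endpoints [c] and [m = g c], with [x] strictly between them. One application of
   [g] moves it past [m], and later iterates stay there because [g] is monotone. *)
pose m := (x + g x) / 2; have [c _ gc] := g_surj m I.
have [xgx|xgx|/esym/gx//] := ltgtP x (g x).
- have /andP[xm mg] : x < m < g x by rewrite !midf_lt.
  have cx : c < x by rewrite -g_mono gc.
  exists c, m; split; first by rewrite in_itv/= cx.
  move=> k w; rewrite !in_itv/= => /andP[cw _]; apply/negP => /andP[_].
  apply/negP; rewrite -leNgt; elim: k => [|k ih] /=.
    by rewrite -gc ltW// g_mono.
  by rewrite -[X in X <= _]gc ltW// g_mono (lt_le_trans _ ih)// (lt_trans cx).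
- have /andP[gm mx] : g x < m < x by rewrite /m addrC !midf_lt.
  have xc : x < c by rewrite -g_mono gc.
  exists m, c; split; first by rewrite in_itv/= mx.
  move=> k w; rewrite !in_itv/= => /andP[_ wc]; apply/negP => /andP[+ _].
  apply/negP; rewrite -leNgt; elim: k => [|k ih] /=.
    by rewrite -[X in _ <= X]gc ltW// g_mono.
  by rewrite -[X in _ <= X]gc ltW// g_mono (le_lt_trans ih)// (lt_trans mx).
Qed.

(** A pi-lambda argument: the open rays are stable under intersection and generate the Borel sets,
    while the sets whose charge [g] preserves form a Dynkin system. *)
Lemma charge_preserving_ray (R : realType)
    (mu : {charge set (measurableTypeR R) -> \bar R}) (g : R -> R) :
  continuous g ->
  (forall x : R, mu (g @^-1` `]x, +oo[) = mu `]x, +oo[%classic) ->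
  charge_preserving mu g.
Proof.
move=> /measurable_realfun.continuous_measurable_fun mg mu_ray.
have mg' (A : set R) : measurable A -> measurable (g @^-1` A).
  by move=> mA; rewrite -[X in measurable X]setTI; exact: mg.
have RE : @measurable _ (measurableTypeR R) =
    <<s @measurable_realfun.RGenOInfty.G R >>.
  exact: measurable_realfun.RGenOInfty.measurableE.
move=> A; rewrite RE => mA.
apply: (dynkin_induction (P := fun A => mu (g @^-1` A) = mu A) RE) mA => //.
- move=> _ _ [x ->] [y ->]; exists (Num.max x y).
  by apply/seteqP; split => z /=; rewrite !in_itv/= !andbT gt_max => /andP.
- by move=> _ [x ->]; exact: mu_ray.
- move=> S mS muS; rewrite preimage_setC !charge_setC ?muS//.
  exact: mg'.
- move=> F mF tF muF; rewrite preimage_bigcup.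
  have mUF : measurable (\bigcup_k F k) by exact: bigcup_measurable.
  have h := @charge_semi_sigma_additive _ _ _ mu F mF tF mUF.
  have : (fun n => \sum_(0 <= i < n) mu (F i))%E @ \oo -->
      mu (\bigcup_k g @^-1` F k).
    under eq_fun do under eq_bigr do rewrite -muF.
    apply: charge_semi_sigma_additive.
    + by move=> n; exact: mg'.
    + by move=> i j _ _ [z Fz]; apply: tF => //; exists (g z).
    + by apply: bigcup_measurable => n _; exact: mg'.
  by move=> /cvg_lim <- //; move: h => /cvg_lim <-.
Qed.

Unset Implicit Arguments.
Set Strict Implicit.

Theorem theorem8p10 (R : realType) (Lambda : R -> R)
    (Lambda01 : forall x : R, 0 <= Lambda x <= 1)
    (Lambda_bv : bounded_variationT Lambda)
    (Lambda_rc : right_continuous Lambda)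
    (mu : {charge set (measurableTypeR R) -> \bar R})
    (mu_Lambda : is_associated_charge Lambda mu)
    (g : R -> R) (g_S : time_change g) :
  [<-> Lambda \o g = Lambda;
       charge_preserving mu g;
       forall x : R, charge_support mu x -> g x = x].
Proof.
have [g_incr g_cont g_surj] := g_S; have g_mono := leW_mono (le_mono g_incr).
tfae.
- move=> Lg; apply: charge_preserving_ray g_cont _ => x.
  have [y _ gy] := g_surj x I.
  have -> : g @^-1` `]x, +oo[ = `]y, +oo[%classic.
    by apply/seteqP; split => z /=; rewrite !in_itv/= !andbT -gy g_mono.
  (* Passing to complements reduces the claim to the values of [Lambda] at [y] and [g y], which
     agree by (a). *)
  rewrite -!setCitvl !charge_setC// !mu_Lambda -gy.
  by move: Lg => /(congr1 (@^~ y)) /= ->.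
- move=> mug x; apply: contraPP => gx.
  have [a [b [xab wab]]] := wandering_interval g_incr g_surj gx.
  apply/existsNP; exists `]a, b[%classic; apply/not_implyP.
  split; first exact: interval_open.
  (* Being wandering passes to subsets, so every Borel part of the interval is null. *)
  apply/not_implyP; split => //; apply/tv_charge_null => [|B mB Bab]; first exact: measurable_itv.
  apply: (charge_wandering _ mug mB).
    exact: measurable_realfun.continuous_measurable_fun.
  by move=> k w /Bab wB /Bab; apply/negP; exact: wab.
- move=> fixg; apply/funext => x /=.
  have Lloc := charge_supportC_locally_constant mu_Lambda.
  have [gx|xg|->//] := ltgtP (g x) x.
    apply: locally_constant_segment; first exact: ltW.
    move=> z; rewrite in_itv/= => /andP[gz zx]; apply: Lloc => /fixg zE.
    (* A fixed [z] differs from [x], which is not fixed; then [z < x] gives [z = g z < g x], against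
       [g x <= z]. *)
    have : z < x by rewrite lt_neqAle zx andbT; apply: contraTneq gx => <-; rewrite zE ltxx.
    by rewrite -g_mono zE ltNge gz.
  apply/esym/locally_constant_segment; first exact: ltW.
  move=> z; rewrite in_itv/= => /andP[xz zg]; apply: Lloc => /fixg zE.
  have : x < z by rewrite lt_neqAle xz andbT; apply: contraTneq xg => ->; rewrite zE ltxx.
  by rewrite -g_mono zE ltNge zg.
Qed.
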